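(* Let $\mathcal{L}=\mathcal{L}_{\mathrm{DLE}}(\mathcal{F},\mathcal{G})$ be an arbitrary normal DLE-language and $\mathcal{L}^\circ$ its associated target language. The correspondence theorem for inductive $\mathcal{L}^\circ$-inequalities transfers to inductive $\mathcal{L}$-inequalities; that is: if every inductive $\mathcal{L}^\circ$-inequality has a first-order correspondent over the class of $\mathcal{L}^\circ$-frames, then every inductive $\mathcal{L}$-inequality has a first-order correspondent over the class of $\mathcal{L}$-frames.
   Context: **Languages.** An order-type over $n\in\mathbb{N}$ is an element $\varepsilon\in\{1,\partial\}^n$; $\varepsilon^\partial$ is the opposite order-type (swap $1$ and $\partial$ in each coordinate). Fix a denumerable set $X=\mathsf{Prop}$ of variables and disjoint sets $\mathcal{F},\mathcal{G}$ of connectives, each $h\in\mathcal{F}\cup\mathcal{G}$ having an arity $n_h$ and an order-type $\varepsilon_h$ over $n_h$. Formulas (terms) of $\mathcal{L}$: $\varphi::=p\mid\bot\mid\top\mid\varphi\wedge\varphi\mid\varphi\vee\varphi\mid f(\overline{\varphi})\mid g(\overline{\varphi})$ with $p\in X$, $f\in\mathcal{F}$, $g\in\mathcal{G}$. An $\mathcal{L}$-inequality is an expression $\varphi\leq\psi$ with $\varphi,\psi\in\mathcal{L}$. The target language $\mathcal{L}^\circ$ is $\alpha::=p\mid\bot\mid\alpha\vee\alpha\mid\alpha\wedge\alpha\mid\neg\alpha\mid f^\circ(\overline{\alpha})\mid g^\circ(\overline{\alpha})\mid\Diamond_{\geq}\alpha\mid\Box_{\leq}\alpha$, with one $f^\circ$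 for each $f\in\mathcal{F}$ and one $g^\circ$ for each $g\in\mathcal{G}$, of the same arity and with order-type constantly $1$ ($\top:=\neg\bot$). **$\mathcal{L}$-frames.** An $\mathcal{L}$-frame is $\mathbb{F}=(W,\leq,\{R_f\}_{f\in\mathcal{F}},\{R_g\}_{g\in\mathcal{G}})$ with $(W,\leq)$ a nonempty poset, $R_f\subseteq W^{n_f+1}$, $R_g\subseteq W^{n_g+1}$ such that: if $R_f(\overline{w})$ and $\overline{w}\leq^{\eta_f}\overline{v}$ then $R_f(\overline{v})$; if $R_g(\overline{w})$ and $\overline{w}\geq^{\eta_g}\overline{v}$ then $R_g(\overline{v})$. Here, for $h\in\mathcal{F}\cup\mathcal{G}$, $\eta_h$ is the order-type over $n_h+1$ with $\eta_h(1)=1$ and $\eta_h(i+1)=\varepsilon_h^\partial(i)$, and $\leq^{\eta}$ is the product order using $\leq$ in coordinates with $\eta(i)=1$ and $\geq$ in coordinates with $\eta(i)=\partial$ ($\geq^\eta$ is its converse). A persistent valuation is a map $V$ from $X$ to the up-sets of $(W,\leq)$. Satisfaction: $\bot,\top,\wedge,\vee$ and variables as usual; $w\Vdash f(\overline{\varphi})$ iff there is $\overline{v}\in W^{n_f}$ with $R_f(w,\overline{v})$ and $v_i\Vdash^{\varepsilon_f(i)}\varphi_i$ for all $i$; $w\Vdash g(\overline{\varphi})$ iff for all $\overline{v}\in W^{n_g}$ with $R_g(w,\overline{v})$, $v_i\Vdash^{\varepsilon_g(i)}\varphi_i$ for some $i$; here $\Vdash^1$ is $\Vdash$ and $\Vdash^\partial$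 is $\nVdash$. $\mathbb{F}\Vdash\varphi\leq\psi$ means: for every persistent valuation and every $w$, if $w\Vdash\varphi$ then $w\Vdash\psi$. **$\mathcal{L}^\circ$-frames.** An $\mathcal{L}^\circ$-frame is $(W,\leq,\{R_f\},\{R_g\})$ with $W$ a nonempty set, $\leq$ a preorder on $W$ and $R_f\subseteq W^{n_f+1}$, $R_g\subseteq W^{n_g+1}$ arbitrary relations. Valuations are arbitrary maps $U\colon X\to\mathcal{P}(W)$; $\neg,\vee,\wedge,\bot$ are interpreted classically; $f^\circ,g^\circ$ are interpreted via $R_f,R_g$ by the clauses above with all order-types equal to $1$; $w\Vdash^*\Box_\leq\alpha$ iff $v\Vdash^*\alpha$ for all $v\geq w$; $w\Vdash^*\Diamond_\geq\alpha$ iff $v\Vdash^*\alpha$ for some $v\leq w$. Validity of $\alpha\leq\beta$ quantifies over all valuations and points. In particular every $\mathcal{L}$-frame is an $\mathcal{L}^\circ$-frame. **First-order correspondent.** An inequality has a first-order correspondent over a class of frames if there is a first-order sentence (with equality) in the language with symbols $\leq$, $R_f$ ($f\in\mathcal{F}$), $R_g$ ($g\in\mathcal{G}$) which is true in exactly those frames of the class in which the inequality is valid. **Inductive inequalities** (for $\mathcal{L}$, and for $\mathcal{L}^\circ$ with $\mathcal{F}^\circ=\{\Diamond_\geq\}\cup\{f^\circ\}$ and $\mathcal{G}^\circ=\{\Box_\leq\}\cup\{g^\circ\}$, all order-types constantly $1$, and $\neg$ counted both as a unary $f$-type and as a unary $g$-type connective of order-type $\partial$). The positive (negative) signed generation tree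 $+s$ ($-s$) of a term $s$ is its syntax tree with the root signed $+$ ($-$), signs propagated as follows: children of $\vee,\wedge$ inherit the sign; the $i$th child of $h$ gets the same sign if $\varepsilon_h(i)=1$ and the opposite sign if $\varepsilon_h(i)=\partial$. Signed nodes are classified as follows. Skeleton nodes: $\Delta$-adjoints ($+\vee,+\wedge,-\wedge,-\vee$) and SLR nodes ($+\wedge$; $+f$ with $n_f\geq1$; $-\vee$; $-g$ with $n_g\geq1$). PIA nodes: SRA nodes ($+\wedge$; $+g$ with $n_g=1$; $-\vee$; $-f$ with $n_f=1$) and SRR nodes ($+\vee$; $+g$ with $n_g\geq2$; $-\wedge$; $-f$ with $n_f\geq2$). For an order-type $\varepsilon$ on the variables, a leaf $+p$ with $\varepsilon(p)=1$ or $-p$ with $\varepsilon(p)=\partial$ is $\varepsilon$-critical; an $\varepsilon$-critical branch is a branch from an $\varepsilon$-critical leaf to the root. A branch is good if it is the concatenation of two paths $P_1,P_2$ (one possibly of length $0$), $P_1$ starting at the leaf and consisting, apart from variable nodes, only of PIA nodes, and $P_2$ consisting, apart from variable nodes, only of Skeleton nodes. Given an irreflexive transitive relation $<_\Omega$ on the variables $p_1,\dots,p_n$, the signed tree $*s$ ($*\in\{+,-\}$) is $(\Omega,\varepsilon)$-inductive if (1) every $\varepsilon$-critical branch is good, and (2) every $m$-ary SRR node occurring in an $\varepsilon$-critical branch with leaf $p_i$ is of the form $\circledast(\gamma_1,\dots,\gamma_{j-1},\beta,\gamma_{j+1},\dots,\gamma_m)$ (the branch passing through $\beta$), where for every $h\neq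 j$: (a) every variable leaf of $\gamma_h$, with the sign inherited from $*s$, is $\varepsilon^\partial$-critical, and (b) $p_k<_\Omega p_i$ for every $p_k$ occurring in $\gamma_h$. An inequality $s\leq t$ is $(\Omega,\varepsilon)$-inductive if $+s$ and $-t$ are; it is inductive if it is $(\Omega,\varepsilon)$-inductive for some $<_\Omega$ and $\varepsilon$. *)

(* Defs.v *)
From mathcomp Require Import all_boot.
From Stdlib Require List.

Set Implicit Arguments.
Unset Strict Implicit.
Unset Printing Implicit Defensive.

Inductive ot : Type := ot1 | otd.

Definition ot_opp (o : ot) : ot := match o with ot1 => otd | otd => ot1 end.

(* F and G are separate types, hence disjoint sets of connectives; no bound is
   put on their cardinality. *)
Record dle_signature : Type := DLESignature {
  Fconn : Type;
  Gconn : Type;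
  Far : Fconn -> nat;
  Gar : Gconn -> nat;
  Fot : forall f : Fconn, 'I_(Far f) -> ot;
  Got : forall g : Gconn, 'I_(Gar g) -> ot }.

(* The denumerable set of propositional variables. *)
Definition pvar : Type := nat.

Inductive form (L : dle_signature) : Type :=
| Var of pvar
| Bot
| Top
| And of form L & form L
| Or of form L & form L
| Fapp (f : Fconn L) of ('I_(Far f) -> form L)
| Gapp (g : Gconn L) of ('I_(Gar g) -> form L).

Inductive formo (L : dle_signature) : Type :=
| Varo of pvar
| Boto
| Oro of formo L & formo L
| Ando of formo L & formo L
| Nego of formo L
| Fappo (f : Fconn L) of ('I_(Far f) -> formo L)
| Gappo (g : Gconn L) of ('I_(Gar g) -> formo L)
| DiaGeq of formo L
| BoxLeq of formo L.

(* A subset of W^(n+1) is given as a relation between its first coordinate and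
   the n-tuple, a function on 'I_n, of the remaining ones. *)
Record Lo_frame (L : dle_signature) : Type := LoFrame {
  world :> Type;
  world_nonempty : inhabited world;
  fle : world -> world -> Prop;
  fle_refl : forall w, fle w w;
  fle_trans : forall u v w, fle u v -> fle v w -> fle u w;
  RF : forall f : Fconn L, world -> ('I_(Far f) -> world) -> Prop;
  RG : forall g : Gconn L, world -> ('I_(Gar g) -> world) -> Prop }.

Definition le_ot (L : dle_signature) (Fr : Lo_frame L) (o : ot) (u v : Fr)
  : Prop :=
  match o with ot1 => fle u v | otd => fle v u end.

(* The compatibility conditions are monotonicity along <=^eta_f (for R_f) and
   along its converse (for R_g), with the coordinate 1, where eta = 1,
   separated from the coordinates i+1, where eta(i+1) is opposite to
   epsilon(i). *)
Record L_frame (L : dle_signature) : Type := LFrame {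
  L_frame_base :> Lo_frame L;
  fle_anti : forall u v : L_frame_base, fle u v -> fle v u -> u = v;
  RF_compat : forall (f : Fconn L) (w w' : L_frame_base)
      (v v' : 'I_(Far f) -> L_frame_base),
    RF w v -> fle w w' ->
    (forall i, le_ot (ot_opp (Fot i)) (v i) (v' i)) -> RF w' v';
  RG_compat : forall (g : Gconn L) (w w' : L_frame_base)
      (v v' : 'I_(Gar g) -> L_frame_base),
    RG w v -> fle w' w ->
    (forall i, le_ot (ot_opp (Got i)) (v' i) (v i)) -> RG w' v' }.

Definition persistent (L : dle_signature) (Fr : L_frame L)
    (V : pvar -> Fr -> Prop) : Prop :=
  forall p (w w' : Fr), fle w w' -> V p w -> V p w'.

Definition holds_ot (o : ot) (P : Prop) : Prop :=
  match o with ot1 => P | otd => ~ P end.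

Fixpoint sat (L : dle_signature) (Fr : L_frame L) (V : pvar -> Fr -> Prop)
    (w : Fr) (phi : form L) {struct phi} : Prop :=
  match phi with
  | Var p => V p w
  | Bot => False
  | Top => True
  | And a b => sat V w a /\ sat V w b
  | Or a b => sat V w a \/ sat V w b
  | Fapp f a =>
      exists v : 'I_(Far f) -> Fr,
        RF w v /\ forall i, holds_ot (Fot i) (sat V (v i) (a i))
  | Gapp g a =>
      forall v : 'I_(Gar g) -> Fr,
        RG w v -> exists i, holds_ot (Got i) (sat V (v i) (a i))
  end.

Definition valid (L : dle_signature) (Fr : L_frame L) (s t : form L) : Prop :=
  forall V : pvar -> Fr -> Prop, persistent V ->
  forall w : Fr, sat V w s -> sat V w t.

Fixpoint sato (L : dle_signature) (Fr : Lo_frame L) (U : pvar -> Fr -> Prop)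
    (w : Fr) (alpha : formo L) {struct alpha} : Prop :=
  match alpha with
  | Varo p => U p w
  | Boto => False
  | Oro a b => sato U w a \/ sato U w b
  | Ando a b => sato U w a /\ sato U w b
  | Nego a => ~ sato U w a
  | Fappo f a =>
      exists v : 'I_(Far f) -> Fr, RF w v /\ forall i, sato U (v i) (a i)
  | Gappo g a =>
      forall v : 'I_(Gar g) -> Fr, RG w v -> exists i, sato U (v i) (a i)
  | DiaGeq a => exists v : Fr, fle v w /\ sato U v a
  | BoxLeq a => forall v : Fr, fle w v -> sato U v a
  end.

Definition valido (L : dle_signature) (Fr : Lo_frame L) (a b : formo L)
  : Prop :=
  forall (U : pvar -> Fr -> Prop) (w : Fr), sato U w a -> sato U w b.

(* The signature is relational, so the only first-order terms are variables,
   which are named by natural numbers. *)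
Inductive fo (L : dle_signature) : Type :=
| FoEq of nat & nat
| FoLe of nat & nat
| FoRF (f : Fconn L) of nat & ('I_(Far f) -> nat)
| FoRG (g : Gconn L) of nat & ('I_(Gar g) -> nat)
| FoFalse
| FoNot of fo L
| FoAnd of fo L & fo L
| FoOr of fo L & fo L
| FoImp of fo L & fo L
| FoAll of nat & fo L
| FoEx of nat & fo L.

Fixpoint fo_free (L : dle_signature) (z : nat) (A : fo L) : Prop :=
  match A with
  | FoEq x y | FoLe x y => z = x \/ z = y
  | FoRF _ x y => z = x \/ exists i, z = y i
  | FoRG _ x y => z = x \/ exists i, z = y i
  | FoFalse => False
  | FoNot B => fo_free z B
  | FoAnd B C | FoOr B C | FoImp B C => fo_free z B \/ fo_free z C
  | FoAll x B | FoEx x B => z <> x /\ fo_free z B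
  end.

Definition fo_sentence (L : dle_signature) (A : fo L) : Prop :=
  forall z, ~ fo_free z A.

Definition assign (T : Type) (e : nat -> T) (x : nat) (w : T) : nat -> T :=
  fun y => if y == x then w else e y.

Fixpoint fo_sat (L : dle_signature) (Fr : Lo_frame L) (e : nat -> Fr)
    (A : fo L) : Prop :=
  match A with
  | FoEq x y => e x = e y
  | FoLe x y => fle (e x) (e y)
  | FoRF f x y => RF (e x) (fun i : 'I_(Far f) => e (y i))
  | FoRG g x y => RG (e x) (fun i : 'I_(Gar g) => e (y i))
  | FoFalse => False
  | FoNot B => ~ fo_sat e B
  | FoAnd B C => fo_sat e B /\ fo_sat e C
  | FoOr B C => fo_sat e B \/ fo_sat e C
  | FoImp B C => fo_sat e B -> fo_sat e C
  | FoAll x B => forall w : Fr, fo_sat (assign e x w) B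
  | FoEx x B => exists w : Fr, fo_sat (assign e x w) B
  end.

(* Only used for sentences, whose truth value does not depend on e. *)
Definition fo_true (L : dle_signature) (Fr : Lo_frame L) (A : fo L) : Prop :=
  forall e : nat -> Fr, fo_sat e A.

Definition has_fo_correspondent (L : dle_signature) (s t : form L) : Prop :=
  exists2 A : fo L, fo_sentence A &
    forall Fr : L_frame L, fo_true Fr A <-> valid Fr s t.

Definition has_fo_correspondento (L : dle_signature) (a b : formo L) : Prop :=
  exists2 A : fo L, fo_sentence A &
    forall Fr : Lo_frame L, fo_true Fr A <-> valido Fr a b.

(* A node of the syntax tree of an L-term or an L°-term; of the connectives in
   F and G only the family, the arity and the order-type are retained. *)
Inductive label : Type :=
| LBot
| LTop
| LAnd
| LOr
| LNeg
| LF (n : nat) of ('I_n -> ot)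
| LG (n : nat) of ('I_n -> ot).

Definition label_ar (l : label) : nat :=
  match l with
  | LBot | LTop => 0
  | LAnd | LOr => 2
  | LNeg => 1
  | LF n _ | LG n _ => n
  end.

Definition label_ot (l : label) : 'I_(label_ar l) -> ot :=
  match l return 'I_(label_ar l) -> ot with
  | LBot | LTop | LAnd | LOr => fun _ => ot1
  | LNeg => fun _ => otd
  | LF _ o | LG _ o => o
  end.

Inductive tree : Type :=
| Leaf of pvar
| Node (l : label) of ('I_(label_ar l) -> tree).

Definition tree0 : 'I_0 -> tree := fun i => match notF (ltn_ord i) with end.
Definition tree1 (a : tree) : 'I_1 -> tree := fun _ => a.
Definition tree2 (a b : tree) : 'I_2 -> tree :=
  fun i => if i == ord0 then a else b.

Definition const_ot1 (n : nat) : 'I_n -> ot := fun _ => ot1.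

Fixpoint tree_of (L : dle_signature) (phi : form L) : tree :=
  match phi with
  | Var p => Leaf p
  | Bot => @Node LBot tree0
  | Top => @Node LTop tree0
  | And a b => @Node LAnd (tree2 (tree_of a) (tree_of b))
  | Or a b => @Node LOr (tree2 (tree_of a) (tree_of b))
  | Fapp f a => @Node (LF (@Fot L f)) (fun i => tree_of (a i))
  | Gapp g a => @Node (LG (@Got L g)) (fun i => tree_of (a i))
  end.

Fixpoint tree_ofo (L : dle_signature) (alpha : formo L) : tree :=
  match alpha with
  | Varo p => Leaf p
  | Boto => @Node LBot tree0
  | Oro a b => @Node LOr (tree2 (tree_ofo a) (tree_ofo b))
  | Ando a b => @Node LAnd (tree2 (tree_ofo a) (tree_ofo b))
  | Nego a => @Node LNeg (tree1 (tree_ofo a))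
  | Fappo f a => @Node (LF (@const_ot1 (Far f))) (fun i => tree_ofo (a i))
  | Gappo g a => @Node (LG (@const_ot1 (Gar g))) (fun i => tree_ofo (a i))
  | DiaGeq a => @Node (LF (@const_ot1 1)) (tree1 (tree_ofo a))
  | BoxLeq a => @Node (LG (@const_ot1 1)) (tree1 (tree_ofo a))
  end.

Inductive sign : Type := Plus | Minus.

Definition sign_opp (s : sign) : sign :=
  match s with Plus => Minus | Minus => Plus end.

Definition sign_ot (s : sign) (o : ot) : sign :=
  match o with ot1 => s | otd => sign_opp s end.

(* Negation is both a unary f-type and a unary g-type connective, so with
   either sign it is an SLR node as well as an SRA node. *)
Definition is_Delta_adjoint (s : sign) (l : label) : bool :=
  match s, l with
  | Plus, LOr | Plus, LAnd | Minus, LAnd | Minus, LOr => true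
  | _, _ => false
  end.

Definition is_SLR (s : sign) (l : label) : bool :=
  match s, l with
  | Plus, LAnd | Minus, LOr => true
  | Plus, LF n _ | Minus, LG n _ => 1 <= n
  | _, LNeg => true
  | _, _ => false
  end.

Definition is_SRA (s : sign) (l : label) : bool :=
  match s, l with
  | Plus, LAnd | Minus, LOr => true
  | Plus, LG n _ | Minus, LF n _ => n == 1
  | _, LNeg => true
  | _, _ => false
  end.

Definition is_SRR (s : sign) (l : label) : bool :=
  match s, l with
  | Plus, LOr | Minus, LAnd => true
  | Plus, LG n _ | Minus, LF n _ => 2 <= n
  | _, _ => false
  end.

Definition is_Skeleton (s : sign) (l : label) : bool :=
  is_Delta_adjoint s l || is_SLR s l.

Definition is_PIA (s : sign) (l : label) : bool := is_SRA s l || is_SRR s l.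

(* A signed inner node together with the coordinate through which a branch
   passes. *)
Record step : Type := Step {
  step_sign : sign;
  step_label : label;
  step_children : 'I_(label_ar step_label) -> tree;
  step_pos : 'I_(label_ar step_label) }.

Definition step_skeleton (x : step) : bool :=
  is_Skeleton (step_sign x) (step_label x).
Definition step_pia (x : step) : bool := is_PIA (step_sign x) (step_label x).
Definition step_srr (x : step) : bool := is_SRR (step_sign x) (step_label x).

(* [branch s t xs s' p]: in the tree t with its root signed s, xs lists, from
   the root down, the inner nodes of a branch whose leaf is the variable p
   with sign s'. *)
Inductive branch : sign -> tree -> seq step -> sign -> pvar -> Prop :=
| branch_leaf s p : branch s (Leaf p) [::] s p
| branch_node s l (c : 'I_(label_ar l) -> tree) j xs s' p :
    branch (sign_ot s (label_ot j)) (c j) xs s' p ->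
    branch s (Node c) (Step s c j :: xs) s' p.

Definition signed_leaf (s : sign) (t : tree) (s' : sign) (p : pvar) : Prop :=
  exists xs, branch s t xs s' p.

(* P1 starts at the leaf, so it is the final segment of the list. *)
Definition good_branch (xs : seq step) : Prop :=
  exists P2 P1, [/\ xs = P2 ++ P1, all step_pia P1 & all step_skeleton P2].

Definition var_ot_opp (eps : pvar -> ot) : pvar -> ot :=
  fun p => ot_opp (eps p).

Definition critical (eps : pvar -> ot) (s : sign) (p : pvar) : Prop :=
  match s with Plus => eps p = ot1 | Minus => eps p = otd end.

(* A variable occurs in a term exactly when it labels a leaf of its tree. *)
Definition side_condition (Omega : pvar -> pvar -> Prop) (eps : pvar -> ot)
    (p : pvar) (x : step) : Prop :=
  forall h : 'I_(label_ar (step_label x)), h <> step_pos x ->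
  forall (s' : sign) (q : pvar),
    signed_leaf (sign_ot (step_sign x) (label_ot h)) (step_children h) s' q ->
    critical (var_ot_opp eps) s' q /\ Omega q p.

Definition inductive_tree (Omega : pvar -> pvar -> Prop) (eps : pvar -> ot)
    (s : sign) (t : tree) : Prop :=
  forall xs s' p, branch s t xs s' p -> critical eps s' p ->
    good_branch xs /\
    forall x, List.In x xs -> step_srr x -> side_condition Omega eps p x.

(* Omega and eps are given on all variables; only their restrictions to the
   variables occurring in s and t matter. *)
Definition inductive_trees (s t : tree) : Prop :=
  exists (Omega : pvar -> pvar -> Prop) (eps : pvar -> ot),
    [/\ forall p, ~ Omega p p,
        forall p q r, Omega p q -> Omega q r -> Omega p r,
        inductive_tree Omega eps Plus s
      & inductive_tree Omega eps Minus t].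

Definition inductive_ineq (L : dle_signature) (s t : form L) : Prop :=
  inductive_trees (tree_of s) (tree_of t).

Definition inductive_ineqo (L : dle_signature) (a b : formo L) : Prop :=
  inductive_trees (tree_ofo a) (tree_ofo b).

(* Main.v *)
Require Import Defs.
From mathcomp Require Import all_boot.
From Stdlib Require List.

Set Implicit Arguments.
Unset Strict Implicit.
Unset Printing Implicit Defensive.

(** The proof is a Goedel-McKinsey-Tarski translation chosen according to the
    order-type [eps] that witnesses inductivity.  An arbitrary subset of a
    preorder can be turned into an up-set in two ways: by taking its interior,
    which [BoxLeq] computes, or its upward closure, which [DiaGeq] computes.
    Prefixing each variable with either operator therefore makes the arbitrary
    valuations of the target language range over exactly the persistent ones
    ([up_valuation]), so the translated inequality is valid in an L-frame
    exactly when the original one is ([valido_translate]), and a first-order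
    sentence for the former also serves for the latter.  Negative coordinates of
    connectives are rendered by classical negation, after which the satisfaction
    clauses of [f] and [g] are those of their counterparts, so no operator is
    put in front of these.

    Which operator to use is dictated by inductivity.  The node put
    above a critical leaf must be PIA: a positive box when [eps p = ot1] and the leaf
    is positive, a negative diamond when [eps p = otd] and the leaf is negative.
    Noncritical leaves may get the wrong kind of node, but nothing is required of
    their branches.  The negations that are inserted are harmless because
    negation is at once PIA and Skeleton and is never SRR.  Hence critical
    branches stay good, and side conditions, which only speak of signed leaves,
    are unaffected ([translate_branches]). *)

(** * The translation and its semantics *)

Definition formo_ot (L : dle_signature) (o : ot) (a : formo L) : formo L :=
  match o with ot1 => a | otd => Nego a end.

Fixpoint translate (L : dle_signature) (eps : pvar -> ot) (phi : form L)
    : formo L :=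
  match phi with
  | Var p => match eps p with
             | ot1 => BoxLeq (Varo L p)
             | otd => DiaGeq (Varo L p)
             end
  | Bot => Boto L
  | Top => Nego (Boto L)
  | And a b => Ando (translate eps a) (translate eps b)
  | Or a b => Oro (translate eps a) (translate eps b)
  | Fapp f a => Fappo (fun i => formo_ot (Fot i) (translate eps (a i)))
  | Gapp g a => Gappo (fun i => formo_ot (Got i) (translate eps (a i)))
  end.

Definition up_valuation (L : dle_signature) (Fr : Lo_frame L) (eps : pvar -> ot)
    (U : pvar -> Fr -> Prop) : pvar -> Fr -> Prop :=
  fun p w => match eps p with
             | ot1 => forall v, fle w v -> U p v
             | otd => exists v, fle v w /\ U p v
             end.

Lemma up_valuation_persistent (L : dle_signature) (Fr : L_frame L)
    (eps : pvar -> ot) (U : pvar -> Fr -> Prop) :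
  persistent (up_valuation eps U).
Proof.
move=> p w w' le_ww'; rewrite /up_valuation; case: (eps p) => /=.
  by move=> Uw v le_w'v; apply: Uw; apply: fle_trans le_ww' le_w'v.
case=> v [le_vw Uv]; exists v; split=> //; exact: fle_trans le_vw le_ww'.
Qed.

Lemma up_valuation_id (L : dle_signature) (Fr : L_frame L)
    (eps : pvar -> ot) (V : pvar -> Fr -> Prop) p w :
  persistent V -> up_valuation eps V p w <-> V p w.
Proof.
move=> persV; rewrite /up_valuation; case: (eps p); split=> /=.
- by apply; apply: fle_refl.
- by move=> Vw v /persV; apply.
- by case=> v [/persV le_vw /le_vw].
- by move=> Vw; exists w; split=> //; apply: fle_refl.
Qed.

Lemma sato_formo_ot (L : dle_signature) (Fr : Lo_frame L)
    (U : pvar -> Fr -> Prop) w o a P :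
  (sato U w a <-> P) -> (sato U w (formo_ot o a) <-> holds_ot o P).
Proof. by case: o => //= aP; split=> nP /aP. Qed.

(** The valuation [V] is only required to agree with [up_valuation eps U]
    pointwise, so that the lemma applies both to the up-set valuation of an
    arbitrary [U] and to a persistent [V] taken as [U] itself. *)
Lemma sato_translate (L : dle_signature) (Fr : L_frame L) (eps : pvar -> ot)
    (U V : pvar -> Fr -> Prop) (phi : form L) :
  (forall p w, up_valuation eps U p w <-> V p w) ->
  forall w, sato U w (translate eps phi) <-> sat V w phi.
Proof.
move=> UV; elim: phi => [p|||a IHa b IHb|a IHa b IHb|f a IH|g a IH] w //=.
- by rewrite -UV /up_valuation; case: (eps p).
- by split=> // _ [].
- by rewrite IHa IHb.
- by rewrite IHa IHb.
- split=> -[v [Rwv sat_v]]; exists v; split=> // i;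
    by apply/(sato_formo_ot (Fot i) (IH i (v i))).
- split=> sat_w v /sat_w [i sat_i]; exists i;
    by apply/(sato_formo_ot (Got i) (IH i (v i))).
Qed.

Lemma valido_translate (L : dle_signature) (Fr : L_frame L) (eps : pvar -> ot)
    (s t : form L) :
  valido Fr (translate eps s) (translate eps t) <-> valid Fr s t.
Proof.
split=> [st V persV w|st U w].
  have VV p v := up_valuation_id eps p v persV.
  by move=> /(sato_translate s VV) /st /(sato_translate t VV).
have UU p v : up_valuation eps U p v <-> up_valuation eps U p v by [].
move=> /(sato_translate s UU) sat_s; apply/(sato_translate t UU).
by apply: st sat_s; apply: up_valuation_persistent.
Qed.

(** * Inductive shape of critical branches *)

Lemma branchE s t xs s' p : branch s t xs s' p ->
  match t with
  | Leaf q => [/\ s' = s, p = q & xs = [::]]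
  | Node l c => exists j ys,
      xs = Step s c j :: ys /\ branch (sign_ot s (label_ot j)) (c j) ys s' p
  end.
Proof. by case=> // {}s l c j ys s1 q br; exists j, ys. Qed.

Lemma good_branch_pia xs : all step_pia xs -> good_branch xs.
Proof. by exists [::], xs. Qed.

Lemma good_branch_skeleton x xs :
  step_skeleton x -> good_branch xs -> good_branch (x :: xs).
Proof.
by move=> skx [P2 [P1 [-> pia1 sk2]]]; exists (x :: P2), P1; rewrite /= skx.
Qed.

Lemma good_branch_consP x xs : good_branch (x :: xs) ->
  all step_pia (x :: xs) \/ step_skeleton x /\ good_branch xs.
Proof.
case=> -[|y P2] [P1 [/= def_xs pia1 sk2]]; first by left; rewrite -def_xs in pia1.
by case: def_xs sk2 => -> -> /andP[sky sk2]; right; split=> //; exists P2, P1.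
Qed.

Definition srr_side_conditions (Omega : pvar -> pvar -> Prop)
    (eps : pvar -> ot) (p : pvar) (xs : seq step) : Prop :=
  forall x, List.In x xs -> step_srr x -> side_condition Omega eps p x.

(** Being entirely PIA is carried along with goodness because a node that is
    PIA but not Skeleton only extends a good branch when everything below it is
    PIA. *)
Definition inherits_shape (Omega : pvar -> pvar -> Prop) (eps : pvar -> ot)
    (p : pvar) (xs0 xs : seq step) : Prop :=
  [/\ all step_pia xs0 -> all step_pia xs,
      good_branch xs0 -> good_branch xs
    & srr_side_conditions Omega eps p xs0 -> srr_side_conditions Omega eps p xs].

Lemma inherits_shape_cons Omega eps p x0 x xs0 xs :
  (step_pia x0 -> step_pia x) -> (step_skeleton x0 -> step_skeleton x) ->
  (step_srr x -> step_srr x0) ->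
  (side_condition Omega eps p x0 -> side_condition Omega eps p x) ->
  inherits_shape Omega eps p xs0 xs ->
  inherits_shape Omega eps p (x0 :: xs0) (x :: xs).
Proof.
move=> pia_x sk_x srr_x side_x [pia_xs good_xs side_xs].
have pia_cons : all step_pia (x0 :: xs0) -> all step_pia (x :: xs).
  by case/andP=> /pia_x px /pia_xs pxs; rewrite /= px.
split=> //.
  case/good_branch_consP=> [/pia_cons /good_branch_pia //|[skx0 good_xs0]].
  exact: good_branch_skeleton (sk_x skx0) (good_xs good_xs0).
move=> side0 y [<-{y} /srr_x srr0|y_xs srr_y].
  by apply: side_x; apply: side0 => //; left.
by apply: side_xs y y_xs srr_y => z z_xs0; apply: side0; right.
Qed.

Lemma inherits_shape_neg Omega eps p s c j xs0 xs :
  inherits_shape Omega eps p xs0 xs ->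
  inherits_shape Omega eps p xs0 (@Step s LNeg c j :: xs).
Proof.
move=> [pia_xs good_xs side_xs]; case: s; split=> //=.
- by move/good_xs; apply: good_branch_skeleton.
- by move/side_xs=> side y [<-|/side].
- by move/good_xs; apply: good_branch_skeleton.
- by move/side_xs=> side y [<-|/side].
Qed.

(** Two root signs are needed since inserting a negation changes the sign of the
    tree above the translated term.  The branch of [t0] is asked for even when
    the leaf is not critical, because side conditions speak of all the leaves of
    the sibling subtrees. *)
Definition branches_from (Omega : pvar -> pvar -> Prop) (eps : pvar -> ot)
    (s0 : sign) (t0 : tree) (s : sign) (t : tree) : Prop :=
  forall xs s' p, branch s t xs s' p -> exists2 xs0, branch s0 t0 xs0 s' p &
    critical eps s' p -> inherits_shape Omega eps p xs0 xs.

Lemma inductive_tree_from Omega eps s t0 t :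
  branches_from Omega eps s t0 s t ->
  inductive_tree Omega eps s t0 -> inductive_tree Omega eps s t.
Proof.
move=> from ind xs s' p /from [xs0 br0 inh] crit.
have [_ good side] := inh crit; have [/good ? /side ?] := ind _ _ _ br0 crit.
by split.
Qed.

Lemma branches_from_neg Omega eps s0 t0 s t :
  branches_from Omega eps s0 t0 (sign_opp s) t ->
  branches_from Omega eps s0 t0 s (@Node LNeg (tree1 t)).
Proof.
move=> from xs s' p /branchE[j [ys [-> /from [xs0 br0 inh]]]].
by exists xs0 => // /inh; apply: inherits_shape_neg.
Qed.

(** The injection [k] identifies the coordinates of two labels whose arities
    agree; it is always the identity, but it spares a cast between the types of
    coordinates. *)
Lemma branches_from_node Omega eps s l0 l (k : 'I_(label_ar l) -> 'I_(label_ar l0))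
    (c0 : 'I_(label_ar l0) -> tree) (c : 'I_(label_ar l) -> tree) :
  injective k -> is_PIA s l0 = is_PIA s l ->
  is_Skeleton s l0 = is_Skeleton s l -> is_SRR s l0 = is_SRR s l ->
  (forall j, branches_from Omega eps (sign_ot s (label_ot (k j))) (c0 (k j))
                                     (sign_ot s (label_ot j)) (c j)) ->
  branches_from Omega eps s (Node c0) s (Node c).
Proof.
move=> inj_k eq_pia eq_sk eq_srr from xs s' p /branchE[j [ys [-> /from]]].
move=> [xs0 br0 inh]; exists (Step s c0 (k j) :: xs0); first exact: branch_node.
move/inh; apply: inherits_shape_cons.
- by rewrite /step_pia /= eq_pia.
- by rewrite /step_skeleton /= eq_sk.
- by rewrite /step_srr /= eq_srr.
move=> side h ne_hj s1 q [zs /from [zs0 brz0 _]].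
apply: (side (k h)); last by exists zs0.
by move/inj_k.
Qed.

Lemma branches_from_formo_ot Omega eps (L : dle_signature) s t0 o (a : formo L) :
  branches_from Omega eps (sign_ot s o) t0 (sign_ot s o) (tree_ofo a) ->
  branches_from Omega eps (sign_ot s o) t0 s (tree_ofo (formo_ot o a)).
Proof. by case: o => //= from; apply: branches_from_neg. Qed.

(** The [Var] case is the only place where the choice of the operator matters:
    on a critical leaf the new node is PIA. *)
Lemma translate_branches Omega eps (L : dle_signature) (phi : form L) s :
  branches_from Omega eps s (tree_of phi) s (tree_ofo (translate eps phi)).
Proof.
elim: phi s => [p|||a IHa b IHb|a IHa b IHb|f a IH|g a IH] s /=.
- have unary_pia x : step_pia x -> ~~ step_srr x ->
      inherits_shape Omega eps p [::] [:: x].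
    move=> pia nsrr; have pia_x : all step_pia [:: x] by rewrite /= pia.
    split=> // [_|_ y]; first exact: good_branch_pia.
    by case=> // <- srr; rewrite srr in nsrr.
  (* The constant order-type keeps the sign, so the leaf is signed [s]. *)
  case eps_p: (eps p) => xs s' q /branchE[j [ys [-> /branchE /= [-> -> ->]]]];
    exists [::] => [|crit]; try exact: branch_leaf;
    by apply: unary_pia; case: s crit => //=; rewrite eps_p.
- by move=> xs s' p /branchE[[]].
- by move=> xs s' p /branchE[j [ys [_ /branchE[[]]]]].
- apply: (@branches_from_node _ _ s LAnd LAnd id) => // j.
  by rewrite /tree2; case: (j == ord0) => /=.
- apply: (@branches_from_node _ _ s LOr LOr id) => // j.
  by rewrite /tree2; case: (j == ord0) => /=.
- apply: (@branches_from_node _ _ s (LF (@Fot L f)) (LF (@const_ot1 _)) id) => //.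
  by move=> j; apply: branches_from_formo_ot.
- apply: (@branches_from_node _ _ s (LG (@Got L g)) (LG (@const_ot1 _)) id) => //.
  by move=> j; apply: branches_from_formo_ot.
Qed.

Lemma inductive_ineqo_translate (L : dle_signature) (s t : form L) :
  inductive_ineq s t ->
  exists eps, inductive_ineqo (translate eps s) (translate eps t).
Proof.
case=> Omega [eps [irr trans ind_s ind_t]]; exists eps, Omega, eps; split=> //.
  exact: inductive_tree_from (@translate_branches Omega eps L s _) ind_s.
exact: inductive_tree_from (@translate_branches Omega eps L t _) ind_t.
Qed.

Theorem theorem6p1 (L : dle_signature) :
  (forall a b : formo L, inductive_ineqo a b -> has_fo_correspondento a b) ->
  (forall s t : form L, inductive_ineq s t -> has_fo_correspondent s t).
Proof.
move=> corr s t /inductive_ineqo_translate[eps /corr[A sentA corrA]].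
by exists A => // Fr; rewrite corrA valido_translate.
Qed.
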